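(* In the unidirectional transaction stream problem with rejection (defined in the context), the deterministic online algorithm ON described in the context is $\left(2+\frac{\sqrt5-1}{2}\right)$-competitive: for every transaction sequence $X_t$, $\mathrm{Cost}_{\mathrm{ON}}(X_t)\le \left(2+\frac{\sqrt5-1}{2}\right)\mathrm{Cost}_{\mathrm{OFF}}(X_t)$.
   Context: Unidirectional transaction stream with rejection. A payment channel $(\ell,r)$; user $\ell$ has balance $b$, initially $0$. A sequence $X_t=(x_1,\dots,x_t)$ of transactions of sizes $x_i\in\mathbb{R}^+$, all in the left-to-right direction, arrives one by one. Each transaction must be accepted or rejected by $\ell$, in order of arrival. Accepting $x$ requires $b\ge x$ and decreases $b$ by $x$ at no cost; rejecting $x$ costs $Rx+f_2$. At any time $\ell$ may recharge the channel on-chain, adding an amount $F$ of funds to $b$, at cost $F+f_1$. Here $R,f_1,f_2\in\mathbb{R}^+$ are constants. The cost of an algorithm is the sum of its rejection and recharging costs. OFF is an optimal offline algorithm (it knows the whole sequence in advance). $A(X)$ denotes the total amount of funds OFF locks in the channel when its whole input is $X$. A transaction of size $x$ is big if $x>Rx+f_2$, and small otherwise. Algorithm ON: maintain $T$, initially $0$. When transaction $x_i$ arrives, let $X_i=(x_1,\dots,x_i)$; if $A(X_i)>T$, set $T\leftarrow A(X_i)+\frac{\sqrt5-1}{2}f_1$ and recharge so that the total amount of funds put into the channel so far equals $T$. Then, if $b\ge x_i$ and $x_i$ is small, accept $x_i$; otherwise reject $x_i$.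
   Formalization: OFF is assumed to lock the largest total amount among all optimal schedules for each input; with arbitrary ties the claim fails, e.g. when OFF always rejects transactions with x = Rx + f2, which ON treats as small and accepts, using up its funds. *)

(* Defs.v *)
From mathcomp Require Import all_boot all_order all_algebra.
From mathcomp Require Import reals.
Set Implicit Arguments.
Unset Strict Implicit.
Unset Printing Implicit Defensive.
Import Order.TTheory GRing.Theory Num.Theory.
Local Open Scope ring_scope.

(* A schedule is the chronological list of what the user does. Each [Accept]
   or [Reject] answers the next transaction of the stream; recharges may occur
   at any point in between, before the first or after the last transaction. *)
Inductive action (K : Type) : Type :=
  | Recharge of K
  | Accept
  | Reject.
Arguments Accept {K}.
Arguments Reject {K}.

Section Channel.
Variable K : realType.
Variables R f1 f2 : K.
Implicit Types (X : seq K) (s : seq (action K)).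

(* [serves b X s]: from balance [b], the schedule [s] can be carried out and
   answers every transaction of [X], in order of arrival. *)
Fixpoint serves (b : K) X s {struct s} : Prop :=
  match s, X with
  | [::], [::] => True
  | Recharge F :: s', _ => 0 < F /\ serves (b + F) X s'
  | Accept :: s', x :: X' => x <= b /\ serves (b - x) X' s'
  | Reject :: s', _ :: X' => serves b X' s'
  | _, _ => False
  end.

(* The value is meaningful only when [s] answers exactly the transactions of
   [X], as [serves] requires. *)
Fixpoint cost X s {struct s} : K :=
  match s, X with
  | Recharge F :: s', _ => (F + f1) + cost X s'
  | Accept :: s', _ :: X' => cost X' s'
  | Reject :: s', x :: X' => (R * x + f2) + cost X' s'
  | _, _ => 0
  end.

Fixpoint locked_funds s : K :=
  match s with
  | [::] => 0
  | Recharge F :: s' => F + locked_funds s'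
  | _ :: s' => locked_funds s'
  end.

Definition transactions X : bool := all (fun x => 0 < x) X.

Definition optimal X s : Prop :=
  serves 0 X s /\ forall s', serves 0 X s' -> cost X s <= cost X s'.

(* Several optimal schedules may exist, locking different amounts. Ties are
   resolved in favour of accepting, as in the definition of a small
   transaction (which includes the case x = R x + f2): among the optimal
   schedules, [OFF X] locks the largest amount. With arbitrary ties the
   competitive ratio of [ON] is not bounded: an [OFF] that locks nothing for
   transactions with x = R x + f2 lets them use up the funds that [ON] needs
   for the other small ones. *)
Definition optimal_offline (OFF : seq K -> seq (action K)) : Prop :=
  forall X, transactions X ->
    optimal X (OFF X) /\
    forall s, optimal X s -> locked_funds s <= locked_funds (OFF X).

Definition big x : bool := R * x + f2 < x.

(* [T] is the total amount put into the channel so far, [b] the balance, and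
   [past] the prefix of the stream that has already been answered. *)
Fixpoint ON_from (A : seq K -> K) (T b : K) (past future : seq K)
    : seq (action K) :=
  match future with
  | [::] => [::]
  | x :: future' =>
      let X := rcons past x in
      let T' := if T < A X then A X + (Num.sqrt 5 - 1) / 2 * f1 else T in
      let b' := b + (T' - T) in
      (if T < A X then [:: Recharge (T' - T)] else [::]) ++
      (if (x <= b') && ~~ big x
       then Accept :: ON_from A T' (b' - x) X future'
       else Reject :: ON_from A T' b' X future')
  end.

Definition ON (A : seq K -> K) X : seq (action K) := ON_from A 0 0 [::] X.

End Channel.

(* Main.v *)
(* The stream is analysed through three sums: the total size [M] of the small
   transactions, the total rejection cost [B] of the big ones, and the total
   saving [G] (rejection cost minus size) of the small ones.

   Offline, one recharge pays for all small transactions, and it is worthwhile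
   exactly when [f1 <= G]. So the optimum is [M + B + min G f1], and [OFF]
   locks [0] if [G < f1] and [M] otherwise.

   Online, everything is rejected until [G] reaches [f1]; up to then the small
   transactions have cost [M + G < M + f1]. From the first recharge on, [T]
   dominates [M], so every small transaction is accepted. With
   [phi := (sqrt 5 - 1) / 2], each later recharge raises [T] by at least
   [phi * f1]; since [phi * (1 + phi) = 1], its fixed fee [f1] is at most
   [1 + phi] times the raise. The recharges therefore cost at most [2 + phi] per
   unit of growth of [M]. *)
Require Import Defs.
From mathcomp Require Import all_boot all_order all_algebra.
From mathcomp Require Import reals.
From mathcomp Require Import ring lra.
Import Order.TTheory GRing.Theory Num.Theory.
Local Open Scope ring_scope.

Local Notation phi := ((Num.sqrt 5 - 1) / 2).

Section Competitive.
Set Implicit Arguments.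
Unset Strict Implicit.
Context {K : realType}.
Variables R f1 f2 : K.
Implicit Types (X Y : seq K) (s : seq (action K)).

(** * Sums over the stream *)

Definition small_total X : K := \sum_(x <- X | ~~ big R f2 x) x.
Definition big_rejection X : K := \sum_(x <- X | big R f2 x) (R * x + f2).
Definition saving X : K := \sum_(x <- X | ~~ big R f2 x) (R * x + f2 - x).

Local Notation M := small_total.
Local Notation B := big_rejection.
Local Notation G := saving.

Lemma small_total_cons x X : M (x :: X) = (if big R f2 x then 0 else x) + M X.
Proof. by rewrite /M big_cons; case: big; rewrite ?add0r. Qed.

Lemma big_rejection_cons x X :
  B (x :: X) = (if big R f2 x then R * x + f2 else 0) + B X.
Proof. by rewrite /B big_cons; case: big; rewrite ?add0r. Qed.

Lemma saving_cons x X :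
  G (x :: X) = (if big R f2 x then 0 else R * x + f2 - x) + G X.
Proof. by rewrite /G big_cons; case: big; rewrite ?add0r. Qed.

Lemma small_total_cat X Y : M (X ++ Y) = M X + M Y.
Proof. exact: big_cat. Qed.

Lemma saving_cat X Y : G (X ++ Y) = G X + G Y.
Proof. exact: big_cat. Qed.

Lemma small_total_rcons X x :
  M (rcons X x) = M X + (if big R f2 x then 0 else x).
Proof.
by rewrite -cats1 small_total_cat small_total_cons {2}/M big_nil addr0.
Qed.

Lemma saving_rcons X x :
  G (rcons X x) = G X + (if big R f2 x then 0 else R * x + f2 - x).
Proof. by rewrite -cats1 saving_cat saving_cons {2}/G big_nil addr0. Qed.

Lemma sums_nil : (M [::] = 0) * (B [::] = 0) * (G [::] = 0).
Proof. by rewrite /M /B /G !big_nil. Qed.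

Definition sums_cons := (small_total_cons, big_rejection_cons, saving_cons).

Lemma small_total_ge0 X : transactions X -> 0 <= M X.
Proof.
move=> /allP X_gt0; rewrite /M big_seq_cond sumr_ge0 // => x.
by move=> /andP[/X_gt0/ltW].
Qed.

Lemma saving_ge0 X : 0 <= G X.
Proof. by rewrite /G sumr_ge0 // => x; rewrite /big -leNgt subr_ge0. Qed.

(** Makes a recharge by [M X] legal offline, and makes [ON] recharge as soon as [G] reaches [f1]. *)
Lemma small_total_gt0 X : transactions X -> 0 < G X -> 0 < M X.
Proof.
elim: X => [|x X IH] /=; first by rewrite sums_nil ltxx.
move=> /andP[x_gt0 X_gt0]; rewrite !sums_cons.
case: big; first by rewrite !add0r; exact: IH.
by have := small_total_ge0 X_gt0; lra.
Qed.

(** * Offline optimum and its locked funds *)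

Fixpoint recharges s : nat :=
  match s with
  | [::] => 0
  | Recharge _ :: s' => (recharges s').+1
  | _ :: s' => recharges s'
  end.

(** Accepting uses up [x] of funds and rejecting costs [R * x + f2]; the smaller of the two is
    counted in [M] for a small [x] and in [B] for a big one. Funds come from [b] or from paid
    recharges. *)
Lemma cost_ge b X s : 0 <= b -> serves b X s ->
  M X + B X + f1 *+ recharges s <= cost R f1 f2 X s + b.
Proof.
elim: s b X => [|[F||] s IH] b [|x X] //= b_ge0.
- by rewrite !sums_nil; lra.
- move=> [F_gt0 /IH]; rewrite mulrS => IHs.
  by have := IHs (addr_ge0 b_ge0 (ltW F_gt0)); lra.
- move=> [F_gt0 /IH]; rewrite mulrS => IHs.
  by have := IHs (addr_ge0 b_ge0 (ltW F_gt0)); lra.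
- move=> [xb /IH IHs]; have := IHs ltac:(lra).
  by rewrite !sums_cons /big; case: ltP; lra.
- move=> /IH IHs; have := IHs b_ge0.
  by rewrite !sums_cons /big; case: ltP; lra.
Qed.

(* Equality in [cost_ge] forces all funds to be used, on small transactions
   only. *)
Lemma locked_funds_le b X s : transactions X -> 0 <= b -> serves b X s ->
  cost R f1 f2 X s + b <= M X + B X + f1 *+ recharges s ->
  b + locked_funds s <= M X.
Proof.
elim: s b X => [|[F||] s IH] b X.
- by case: X => //= _ _ _; rewrite !sums_nil; lra.
- move=> X_gt0 b_ge0 [F_gt0 sX] /=; rewrite mulrS => cost_le.
  have bF_ge0 : 0 <= b + F by lra.
  by have := IH _ _ X_gt0 bF_ge0 sX; case: X X_gt0 sX cost_le => *; lra.
- case: X => //= x X /andP[x_gt0 X_gt0] b_ge0 [xb sX].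
  have bx_ge0 : 0 <= b - x by lra.
  have := cost_ge bx_ge0 sX; have := IH _ _ X_gt0 bx_ge0 sX.
  by rewrite !sums_cons /big; case: ltP; lra.
- case: X => //= x X /andP[x_gt0 X_gt0] b_ge0 sX.
  have := IH _ _ X_gt0 b_ge0 sX.
  by rewrite !sums_cons /big; case: ltP; lra.
Qed.

Lemma recharges0_locked_funds s : recharges s = 0 -> locked_funds s = 0.
Proof. by elim: s => [|[]]. Qed.

(** Without a recharge the balance stays [0], so everything is rejected; for a small [x] this costs
    [x] plus its saving. *)
Lemma recharges0_cost X s : transactions X -> serves 0 X s ->
  recharges s = 0 -> cost R f1 f2 X s = M X + B X + G X.
Proof.
elim: s X => [|[F||] s IH] [|x X] //=; first by rewrite !sums_nil !addr0.
  by move=> /andP[x_gt0 _] [x_le0]; lra.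
move=> /andP[_ X_gt0] sX s0; rewrite IH // !sums_cons.
by case: big; lra.
Qed.

Lemma serves_reject_all b X : serves b X (nseq (size X) Reject).
Proof. by elim: X. Qed.

Lemma recharges_reject_all n : recharges (nseq n Reject) = 0.
Proof. by elim: n. Qed.

Definition answers X : seq (action K) :=
  [seq if big R f2 x then Reject else Accept | x <- X].

Lemma serves_answers X b : transactions X -> M X <= b -> serves b X (answers X).
Proof.
elim: X b => //= x X IH b /andP[x_gt0 X_gt0]; rewrite !sums_cons.
have := small_total_ge0 X_gt0.
by case: big => /= M_ge0 Mb; [|split; first lra]; apply: IH => //; lra.
Qed.

Lemma cost_answers X : cost R f1 f2 X (answers X) = B X.
Proof.
elim: X => [|x X IH] /=; first by rewrite sums_nil.
by rewrite sums_cons; case: big; rewrite /= IH ?add0r.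
Qed.

Lemma locked_funds_answers X : locked_funds (answers X) = 0.
Proof. by elim: X => //= x X; case: big. Qed.

(** By [cost_ge], a schedule with a recharge costs at least [M X + B X + f1], more than rejecting
    everything. *)
Lemma optimal_unfunded X s : 0 < f1 -> transactions X -> G X < f1 ->
  optimal R f1 f2 X s ->
  locked_funds s = 0 /\ cost R f1 f2 X s = M X + B X + G X.
Proof.
move=> f1_gt0 X_gt0 G_lt [sX /(_ _ (serves_reject_all 0 X))].
rewrite (recharges0_cost X_gt0 (serves_reject_all 0 X)); last first.
  exact: recharges_reject_all.
have := cost_ge (lexx 0) sX; case s0: (recharges s) => [|n].
  by rewrite recharges0_locked_funds // recharges0_cost.
rewrite mulrS; have := mulrn_wge0 n (ltW f1_gt0); lra.
Qed.

Lemma optimal_funded X s : 0 < f1 -> transactions X -> f1 <= G X ->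
  optimal R f1 f2 X s ->
  (forall s', optimal R f1 f2 X s' -> locked_funds s' <= locked_funds s) ->
  locked_funds s = M X /\ cost R f1 f2 X s = M X + B X + f1.
Proof.
move=> f1_gt0 X_gt0 G_ge [sX s_min] s_max.
have M_gt0 : 0 < M X by apply: small_total_gt0 => //; lra.
pose s1 := Recharge (M X) :: answers X.
have s1X : serves 0 X s1.
  by rewrite /s1 /= add0r; split=> //; exact: serves_answers.
have cost_s1 : cost R f1 f2 X s1 = M X + B X + f1.
  by rewrite /s1 /=; have := cost_answers X; case: (X) => *; lra.
have cost_min s' : serves 0 X s' -> M X + B X + f1 <= cost R f1 f2 X s'.
  move=> s'X; have := cost_ge (lexx 0) s'X; case s0: (recharges s') => [|n].
    by rewrite (recharges0_cost X_gt0 s'X) //; lra.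
  by rewrite mulrS; have := mulrn_wge0 n (ltW f1_gt0); lra.
have cost_s : cost R f1 f2 X s = M X + B X + f1.
  by apply/eqP; rewrite eq_le cost_min // -cost_s1 s_min.
split=> //; apply/eqP; rewrite eq_le; apply/andP; split; last first.
  (* [s1] is optimal too, so the tie-break in favour of larger locked funds applies to it. *)
  have := s_max s1; rewrite /s1 /= locked_funds_answers addr0; apply.
  by split=> // s' /cost_min; rewrite cost_s1.
case s0: (recharges s) => [|n]; first by rewrite recharges0_locked_funds // ltW.
rewrite -[locked_funds s]add0r; apply: locked_funds_le => //.
by rewrite cost_s s0 mulrS; have := mulrn_wge0 n (ltW f1_gt0); lra.
Qed.

(** * Cost of the online algorithm *)

Lemma phi_gt0 : 0 < phi :> K.
Proof.
have : Num.sqrt 1 < Num.sqrt 5 :> K by rewrite ltr_sqrt; lra.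
by rewrite sqrtr1; lra.
Qed.

Lemma phi_golden : phi * (1 + phi) = 1 :> K.
Proof.
have : Num.sqrt 5 ^+ 2 = 5 :> K by rewrite sqr_sqrtr; lra.
by move=> sq5; field: sq5.
Qed.

Section Online.
Variable A : seq K -> K.
Hypothesis f1_gt0 : 0 < f1.
Hypothesis A_unfunded : forall Y, transactions Y -> G Y < f1 -> A Y = 0.
Hypothesis A_funded : forall Y, transactions Y -> f1 <= G Y -> A Y = M Y.

(* Before a further recharge [T - phi * f1] is the value of [M] at the last one,
   so the second term of the bound is [2 + phi] times the growth of [M] since
   then. *)
Lemma cost_ON_funded T b past future :
    transactions (past ++ future) -> f1 <= G past ->
    M past <= T <= M past + phi * f1 -> T - M past <= b ->
  cost R f1 f2 future (ON_from R f1 f2 A T b past future) <=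
    B future + (2 + phi) * (M (past ++ future) + phi * f1 - T).
Proof.
have phi0 := phi_gt0; have phiE := phi_golden.
elim: future T b past => [|x X IH] T b past.
  rewrite cats0 /= sums_nil => _ _ /andP[_ T_le] _.
  by rewrite add0r mulr_ge0 //; lra.
rewrite -cat_rcons; set Y := rcons past x => X_gt0 G_ge T_bnd b_ge.
have /andP[Y_gt0 _] : transactions Y && transactions X by rewrite -all_cat.
have x_gt0 : 0 < x by move: Y_gt0; rewrite /transactions all_rcons => /andP[].
have GY : f1 <= G Y by rewrite saving_rcons /big; case: ltP; lra.
have MY : M Y = M past + _ := small_total_rcons past x.
have phif1 := mulr_gt0 phi0 f1_gt0.
have answer T' b' : M Y <= T' <= M Y + phi * f1 -> T' - M past <= b' ->
  cost R f1 f2 (x :: X) (if (x <= b') && ~~ big R f2 x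
     then Accept :: ON_from R f1 f2 A T' (b' - x) Y X
     else Reject :: ON_from R f1 f2 A T' b' Y X)
  <= B (x :: X) + (2 + phi) * (M (Y ++ X) + phi * f1 - T').
  rewrite sums_cons => T'_bnd b'_ge.
  case x_big: (big R f2 x) in MY *; rewrite ?andbF ?andbT /=.
    by have := IH T' b' Y X_gt0 GY T'_bnd ltac:(lra); lra.
  (* Here [M Y = M past + x], so [b' >= T' - M past >= x]. *)
  have -> : x <= b' by lra.
  by have := IH T' (b' - x) Y X_gt0 GY T'_bnd ltac:(lra); rewrite /=; lra.
rewrite /= -/Y A_funded //; case: ltP => [T_lt|T_ge]; last first.
  by rewrite subrr addr0; apply: answer => //; move: MY; case: ifP; lra.
have fee : f1 <= (1 + phi) * (M Y + phi * f1 - T).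
  have f1E : f1 = (1 + phi) * (phi * f1).
    by rewrite mulrA [(1 + phi) * _]mulrC phiE mul1r.
  by rewrite {1}f1E ler_wpM2l; lra.
rewrite /=; set T' := M Y + phi * f1 in fee *.
have := answer T' (b + (T' - T)) ltac:(rewrite /T'; lra) ltac:(lra).
by move: fee; lra.
Qed.

(** [M past + G past] is the cost already paid for rejecting the small transactions of [past]; the
    induction carries it up to the first recharge. *)
Lemma cost_ON_unfunded past future :
    transactions (past ++ future) -> G past < f1 ->
  cost R f1 f2 future (ON_from R f1 f2 A 0 0 past future) + M past + G past <=
    if G (past ++ future) < f1
    then B future + M (past ++ future) + G (past ++ future)
    else B future + (2 + phi) * (M (past ++ future) + f1).
Proof.
have phi0 := phi_gt0; have phiE := phi_golden.
have phif1 := mulr_gt0 phi0 f1_gt0.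
elim: future past => [|x X IH] past.
  by rewrite cats0 => _ G_lt; rewrite G_lt /= sums_nil; lra.
rewrite -cat_rcons; set Y := rcons past x => YX_gt0 G_lt.
have /andP[Y_gt0 X_gt0] : transactions Y && transactions X by rewrite -all_cat.
have /andP[x_gt0 past_gt0] : (0 < x) && transactions past.
  by rewrite -[_ && _]all_rcons.
have MY : M Y = M past + _ := small_total_rcons past x.
have GY : G Y = G past + _ := saving_rcons past x.
have G_YX : G (Y ++ X) = G Y + G X := saving_cat Y X.
have GX_ge0 := saving_ge0 X.
have M_ge0 := small_total_ge0 past_gt0.
rewrite sums_cons /= -/Y.
have [GY_lt|GY_ge] := ltP (G Y) f1.
  rewrite A_unfunded // ltxx subrr addr0 [x <= 0]leNgt x_gt0 /=.
  have := IH Y YX_gt0 GY_lt.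
  by move: MY GY; case: big; case: ltP; lra.
have MY_gt0 := small_total_gt0 Y_gt0 (lt_le_trans f1_gt0 GY_ge).
rewrite A_funded // MY_gt0 (ltNge (G (Y ++ X))) G_YX.
have -> : f1 <= G Y + G X by lra.
(* A big [x] leaves [G] unchanged, so it cannot be where [G] reaches [f1]. *)
case x_big: (big R f2 x) in MY GY *; first lra.
rewrite /= andbT.
have -> : x <= 0 + (M Y + phi * f1 - 0) by lra.
rewrite /=.
(* Earlier small rejections cost less than [M past + f1] and the first recharge costs
   [M Y + (1 + phi) * f1]: together at most [(2 + phi) * (M Y + f1)]. The rest costs [2 + phi] per
   unit of growth of [M] beyond [M Y], plus big rejections. *)
have := @cost_ON_funded (M Y + phi * f1) (0 + (M Y + phi * f1 - 0) - x) Y X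
  YX_gt0 GY_ge ltac:(lra) ltac:(lra).
have := mulr_ge0 (ltW phi0) (ltW MY_gt0).
lra.
Qed.
End Online.
End Competitive.

Theorem theorem3 (K : realType) (R f1 f2 : K)
    (hR : 0 < R) (hf1 : 0 < f1) (hf2 : 0 < f2)
    (OFF : seq K -> seq (action K)) (hOFF : optimal_offline R f1 f2 OFF)
    (X : seq K) (hX : transactions X) :
  cost R f1 f2 X (ON R f1 f2 (fun Y => locked_funds (OFF Y)) X)
    <= (2 + (Num.sqrt 5 - 1) / 2) * cost R f1 f2 X (OFF X).
Proof.
have unfunded Y (Y_gt0 : transactions Y) (G_lt : saving R f2 Y < f1) :=
  optimal_unfunded hf1 Y_gt0 G_lt (hOFF Y Y_gt0).1.
have funded Y (Y_gt0 : transactions Y) (G_ge : f1 <= saving R f2 Y) :=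
  optimal_funded hf1 Y_gt0 G_ge (hOFF Y Y_gt0).1 (hOFF Y Y_gt0).2.
have := cost_ON_unfunded hf1 (fun Y h1 h2 => (unfunded Y h1 h2).1)
  (fun Y h1 h2 => (funded Y h1 h2).1) (past := [::]) hX.
rewrite /= !sums_nil !addr0 => /(_ hf1).
have phi0 := @phi_gt0 K; have M_ge0 := small_total_ge0 R f2 hX.
have G_ge0 := saving_ge0 R f2 X.
have B_ge0 : 0 <= big_rejection R f2 X.
  rewrite /big_rejection big_seq_cond sumr_ge0 // => x.
  by move=> /andP[/(allP hX) x_gt0 _]; rewrite addr_ge0 ?mulr_ge0 // ltW.
rewrite /ON; case: ltP => [G_lt|G_ge] /le_trans; apply.
  rewrite (unfunded X hX G_lt).2 [big_rejection _ _ _ + _]addrC.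
  by rewrite ler_peMl; lra.
rewrite (funded X hX G_ge).2.
have := mulr_ge0 (ltW phi0) B_ge0; lra.
Qed.
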